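(* Let $0<\epsilon,\delta<1$, $F=1-\epsilon$, and let $\Omega$ be a positive-definite verification operator for $|\Psi\rangle$ with eigenvalues $1=\lambda_1>\lambda_2\ge\dots\ge\lambda_D>0$, second largest eigenvalue $\beta=\lambda_2$ and smallest eigenvalue $\tau=\lambda_D$, where $0<\tau\le\beta<1$. Let $h=[\min\{\beta\ln\beta^{-1},\tau\ln\tau^{-1}\}]^{-1}$, let $\tilde\beta=\beta$ if $\beta\ln\beta^{-1}\le\tau\ln\tau^{-1}$ and $\tilde\beta=\tau$ otherwise, and for $0<x<1$ let $k_-(x)=\lfloor(\ln\delta)/\ln x\rfloor$. Then for $j=2,3,\dots,D$, $$N(\epsilon,\delta,\Omega)\ge N(\epsilon,\delta,\lambda_j)\ge k_-(\lambda_j)+\Big\lceil\frac{k_-(\lambda_j)F}{\lambda_j\epsilon}\Big\rceil;$$ moreover $$k_-(\tilde\beta)+\Big\lceil\frac{k_-(\tilde\beta)F}{\tilde\beta\epsilon}\Big\rceil\le N(\epsilon,\delta,\Omega)\le\Big\lceil\frac{hF\ln(F\delta)^{-1}}{\epsilon}+\frac{\ln(F\delta)}{\ln\beta}-1\Big\rceil<\frac{h\ln(F\delta)^{-1}}{\epsilon},$$ $$N(\epsilon,\delta,\Omega)\le\Big\lceil\frac{hF\ln(\tau\delta)^{-1}}{\epsilon}+\frac{\ln(\tau\delta)}{\ln\beta}-1\Big\rceil<\frac{h\ln(\tau\delta)^{-1}}{\epsilon}.$$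
   Context: Let $\mathcal H$ be a Hilbert space of finite dimension $D\ge2$ and $|\Psi\rangle\in\mathcal H$ a unit vector. A verification operator for $|\Psi\rangle$ is a Hermitian operator $\Omega$ on $\mathcal H$ with $0\le\Omega\le1$, $\Omega|\Psi\rangle=|\Psi\rangle$, whose eigenvalue $1$ is nondegenerate. For an integer $N\ge1$ and a density operator $\rho$ on $\mathcal H^{\otimes(N+1)}$ put $p_\rho=\mathrm{tr}[(\Omega^{\otimes N}\otimes 1)\rho]$ and $f_\rho=\mathrm{tr}[(\Omega^{\otimes N}\otimes|\Psi\rangle\langle\Psi|)\rho]$, $F(N,\delta,\Omega)=\min\{f_\rho/p_\rho:p_\rho\ge\delta\}$ for $0<\delta\le1$ (minimum over permutation-invariant density operators on $\mathcal H^{\otimes(N+1)}$), and for $0<\epsilon,\delta<1$, $N(\epsilon,\delta,\Omega)=\min\{N\ge1:F(N,\delta,\Omega)\ge1-\epsilon\}$. For $0\le\lambda<1$, $N(\epsilon,\delta,\lambda)$ denotes $N(\epsilon,\delta,\Omega_\lambda)$ for the homogeneous operator $\Omega_\lambda=|\Psi\rangle\langle\Psi|+\lambda(1-|\Psi\rangle\langle\Psi|)$. *)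

(* Defs.v *)
From HB Require Import structures.
From mathcomp Require Import all_boot all_order all_algebra perm complex.
From mathcomp Require Import classical_sets reals exp.
Set Implicit Arguments. Unset Strict Implicit. Unset Printing Implicit Defensive.
Import Order.TTheory GRing.Theory Num.Theory.
Local Open Scope ring_scope.

Section QV.
Variables (R : realType) (D : nat).
Local Notation C := R[i].

Definition adjmx m k (A : 'M[C]_(m, k)) : 'M[C]_(k, m) := (map_mx Num.conj A)^T.

Definition hermitian (A : 'M[C]_D) : Prop := adjmx A = A.

Definition qform (A : 'M[C]_D) (v : 'cV[C]_D) : C := (adjmx v *m A *m v) 0 0.

Definition unit_vector (Psi : 'cV[C]_D) : Prop := (adjmx Psi *m Psi) 0 0 = 1.

Definition verification_operator (Omega : 'M[C]_D) (Psi : 'cV[C]_D) : Prop :=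
  [/\ hermitian Omega,
      (forall v : 'cV[C]_D, 0 <= qform Omega v /\ qform Omega v <= qform 1%:M v),
      Omega *m Psi = Psi &
      \rank (eigenspace Omega 1) = 1%N].

Definition proj (Psi : 'cV[C]_D) : 'M[C]_D := Psi *m adjmx Psi.

Definition homog_op (Psi : 'cV[C]_D) (lam : R) : 'M[C]_D :=
  proj Psi + (lam%:C)%C *: (1%:M - proj Psi).

(* The computational basis of H^{(x)m} is indexed by {ffun 'I_m -> 'I_D};
   operators on H^{(x)m} are given by their matrix elements. *)
Definition tidx (m : nat) := {ffun 'I_m -> 'I_D}.
Definition top (m : nat) := tidx m -> tidx m -> C.

Definition ttrace m (A : top m) : C := \sum_x A x x.
Definition tmul m (A B : top m) : top m := fun x y => \sum_z A x z * B z y.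

Definition density_op m (rho : top m) : Prop :=
  [/\ (forall x y, rho y x = Num.conj (rho x y)),
      (forall v : tidx m -> C,
          0 <= \sum_x \sum_y Num.conj (v x) * rho x y * v y) &
      ttrace rho = 1].

Definition perm_invariant m (rho : top m) : Prop :=
  forall (s : {perm 'I_m}) (x y : tidx m),
    rho [ffun i => x (s i)] [ffun i => y (s i)] = rho x y.

(* Omega^{(x)N} (x) 1   (first N factors Omega, last factor identity) *)
Definition test_op (Omega : 'M[C]_D) (N : nat) : top N.+1 :=
  fun x y => (\prod_(i < N) Omega (x (widen_ord (leqnSn N) i))
                                  (y (widen_ord (leqnSn N) i)))
             * (x ord_max == y ord_max)%:R.

(* Omega^{(x)N} (x) |Psi><Psi| *)
Definition fid_op (Omega : 'M[C]_D) (Psi : 'cV[C]_D) (N : nat) : top N.+1 :=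
  fun x y => (\prod_(i < N) Omega (x (widen_ord (leqnSn N) i))
                                  (y (widen_ord (leqnSn N) i)))
             * proj Psi (x ord_max) (y ord_max).

Definition p_rho Omega N (rho : top N.+1) : C := ttrace (tmul (@test_op Omega N) rho).
Definition f_rho Omega Psi N (rho : top N.+1) : C :=
  ttrace (tmul (@fid_op Omega Psi N) rho).

(* F(N, delta, Omega) = min { f_rho / p_rho : p_rho >= delta } over
   permutation-invariant density operators on H^{(x)(N+1)}
   (the minimum is attained, so it equals the infimum used here). *)
Definition Fmin (N : nat) (delta : R) (Omega : 'M[C]_D) (Psi : 'cV[C]_D) : R :=
  inf [set r : R | exists rho : top N.+1,
         [/\ density_op rho, perm_invariant rho,
             (delta%:C)%C <= p_rho Omega rho &
             r = complex.Re (f_rho Omega Psi rho / p_rho Omega rho)]].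

Definition is_Nnum (eps delta : R) (Omega : 'M[C]_D) (Psi : 'cV[C]_D) (Nv : nat)
  : Prop :=
  [/\ (1 <= Nv)%N, 1 - eps <= Fmin Nv delta Omega Psi &
      forall N, (1 <= N)%N -> 1 - eps <= Fmin N delta Omega Psi -> (Nv <= N)%N].

End QV.
Arguments test_op {R D} Omega N.
Arguments fid_op {R D} Omega Psi N.

Definition kminus (R : realType) (delta x : R) : int := Num.floor (ln delta / ln x).

(* Main.v *)
(* In an orthonormal eigenbasis of Omega containing Psi, only the diagonal of
   rho in the product basis matters, so (p_rho, f_rho) ranges over the convex
   hull of finitely many points, one for each configuration z of eigenvalues:
   with Lam = prod_i lam(z i) and T = N + 1 they are
     p(z) = Lam/T * sum_k 1/lam(z k),  f(z) = Lam/T * #{k | z k = 0}.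
   Configurations using only the eigenvalues 1 and lam j are the ones of the
   homogeneous operator, which gives N(Omega) >= N(lam j); the explicit lower
   bound comes from mixing the configurations with k and k + 1 non-target sites
   so that p = (lam j)^k exactly.
   For the upper bounds, write L = - ln d with d = F delta or d = tau delta.
   If N + 1 >= L (h F / eps + 1 / ln beta^-1), every configuration satisfies
   L (f - F p) >= eps (Lam - d).  As f <= Lam and p <= Lam / tau, averaging
   gives f >= F p as soon as p >= delta, in either case. *)
Require Import Defs.
From HB Require Import structures.
From mathcomp Require Import all_boot all_order all_algebra perm complex.
From mathcomp Require Import spectral ring lra.
From mathcomp Require Import classical_sets reals sequences exp.
Import Order.TTheory GRing.Theory Num.Theory.
Local Open Scope ring_scope.
Set Implicit Arguments. Unset Strict Implicit. Unset Printing Implicit Defensive.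

(** * Diagonalisation *)

Lemma char_poly_simmx (F : fieldType) n (P A : 'M[F]_n) :
  P \in unitmx -> char_poly (invmx P *m A *m P) = char_poly A.
Proof.
move=> Pu; rewrite /char_poly.
have -> : char_poly_mx (invmx P *m A *m P) =
    map_mx polyC (invmx P) *m char_poly_mx A *m map_mx polyC P.
  rewrite /char_poly_mx mulmxBr mulmxBl !map_mxM; congr (_ - _).
  by rewrite mul_mx_scalar -scalemxAl -map_mxM mulVmx // map_mx1 scalemx1.
rewrite !det_mulmx mulrC mulrA -det_mulmx -map_mxM mulmxV // map_mx1 det1.
by rewrite mul1r.
Qed.

Section Diag.
Variables (R : realType) (D : nat).
Local Notation C := R[i].
Implicit Types (U Omega : 'M[C]_D) (lam : 'I_D -> R).

Definition diagU U lam := U *m diag_mx (\row_j ((lam j)%:C)%C) *m adjmx U.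

Lemma diagUE U lam x y :
  diagU U lam x y = \sum_j U x j * ((lam j)%:C)%C * Num.conj (U y j).
Proof.
rewrite /diagU !mxE; apply: eq_bigr => j _.
by rewrite mul_mx_diag !mxE.
Qed.

(** The spectral theorem diagonalises [Omega] with its eigenvalues in some order. Both lists are the
    roots of the same characteristic polynomial, so they differ by a permutation [s], which is then
    applied to the eigenvector columns. *)
Lemma hermitian_diagonalization Omega lam :
  Defs.hermitian Omega -> char_poly Omega = \prod_j ('X - ((lam j)%:C)%C%:P) ->
  exists2 U, adjmx U *m U = 1%:M & Omega = diagU U lam.
Proof.
move=> hO cO.
have nO : Omega \is normalmx.
  apply/normalmxP; have -> : map_mx Num.conj Omega^T = Omega.
    by rewrite -map_trmx.
  by [].
have /orthomx_spectralP := nO.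
set P := spectralmx Omega; set sp := spectral_diag Omega => OE.
have Pun : P \is unitarymx := spectral_unitarymx _.
have Pu : P \in unitmx := spectral_unit _.
have cO' : char_poly Omega = \prod_j ('X - (sp 0 j)%:P).
  rewrite OE char_poly_simmx // char_poly_trig; last first.
    by apply: diag_mx_is_trig.
  by apply: eq_bigr => i _; rewrite mxE eqxx mulr1n.
have : perm_eq [tuple ((lam i)%:C)%C | i < D] [tuple sp 0 i | i < D].
  apply: prod_XsubC_eq; rewrite !big_map -enumT !big_enum /= -cO' cO.
  by [].
case/tuple_permP=> s /(congr1 (fun t => nth 0 t)) Es.
have {Es}Es i : ((lam i)%:C)%C = sp 0 (s i).
  have := congr1 (fun f => f (val i)) Es.
  by rewrite -!tnth_nth !tnth_mktuple.
have PE : invmx P = adjmx P by rewrite invmx_unitary // -map_trmx.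
exists (col_perm s (adjmx P)).
  apply/matrixP => i j; rewrite !mxE.
  have /matrixP/(_ (s i) (s j)) := mulmxV Pu.
  rewrite PE !mxE (inj_eq perm_inj) => <-.
  by apply: eq_bigr => k _; rewrite !mxE conjCK.
apply/matrixP => i k; rewrite diagUE {1}OE PE !mxE (reindex_inj (@perm_inj _ s)).
by apply: eq_bigr => j _; rewrite mul_mx_diag !mxE conjCK Es.
Qed.

Lemma diagU_idmx U : U *m adjmx U = 1%:M -> diagU U (fun=> 1) = 1%:M.
Proof.
move=> UU; rewrite /diagU -[RHS]UU; congr (_ *m _).
by apply/matrixP => i j; rewrite mul_mx_diag !mxE mulr1.
Qed.

(** The coordinates [c] of [Psi] in the eigenbasis satisfy [(lam j - 1) * c j = 0], so only [c i0]
    survives. It is a phase, and the phase cancels in the projector. *)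
Lemma proj_diagU U Omega lam (Psi : 'cV[C]_D) i0 :
  adjmx U *m U = 1%:M -> Omega = diagU U lam -> Omega *m Psi = Psi ->
  unit_vector Psi -> (forall j, j != i0 -> lam j != 1) ->
  proj Psi = diagU U (fun j => (j == i0)%:R).
Proof.
move=> UU OE OP Pu lam1.
pose c := adjmx U *m Psi.
have PE : Psi = U *m c by rewrite mulmxA (mulmx1C UU) mul1mx.
have c0 j : j != i0 -> c j 0 = 0.
  move=> jn; have /matrixP/(_ j 0) : diag_mx (\row_j ((lam j)%:C)%C) *m c = c.
    rewrite -[LHS]mul1mx -UU -!mulmxA; congr (_ *m _).
    by rewrite -[RHS]OP OE /diagU -!mulmxA.
  rewrite mul_diag_mx !mxE => /eqP; rewrite -subr_eq0 -{2}[\sum_ _ _]mul1r -mulrBl.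
  rewrite mulf_eq0 => /orP[|/eqP //].
  by rewrite subr_eq0 -[1]/(1%:C)%C (inj_eq (@complexI _)) (negPf (lam1 _ jn)).
have c1 : c i0 0 * Num.conj (c i0 0) = 1.
  move: Pu; rewrite /unit_vector.
  have -> : adjmx Psi *m Psi = adjmx c *m c.
    rewrite {1}PE /adjmx map_mxM trmx_mul -mulmxA; congr (_ *m _).
  rewrite mxE (bigD1 i0) //= big1 ?addr0 => [|j jn]; last by rewrite c0 // mulr0.
  by rewrite mxE [(map_mx _ _) _ _]mxE mulrC.
clearbody c.
rewrite /proj /diagU PE /adjmx map_mxM trmx_mul !mulmxA; congr (_ *m _).
rewrite -!mulmxA; congr (_ *m _); apply/matrixP => i j.
rewrite !mxE big_ord1 !mxE.
have [-> | jn] := eqVneq i j; last first.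
  have [ji|ji] := eqVneq i i0; last by rewrite c0 // mul0r.
  have -> : c j ord0 = 0 by apply: c0; rewrite -ji eq_sym.
  by rewrite rmorph0 mulr0.
rewrite mulr1n; have [-> //|ji] := eqVneq j i0.
by rewrite c0 // mul0r.
Qed.

Lemma homog_op_diagU U (Psi : 'cV[C]_D) i0 l :
  adjmx U *m U = 1%:M -> proj Psi = diagU U (fun j => (j == i0)%:R) ->
  homog_op Psi l = diagU U (fun j => if j == i0 then 1 else l).
Proof.
move=> UU PE; rewrite /homog_op PE -(diagU_idmx (mulmx1C UU)).
have entry (c : C) (A B : 'M[C]_D) x y :
  (A + c *: (B - A)) x y = A x y + c * (B x y - A x y) by rewrite !mxE.
apply/matrixP => x y; rewrite entry !diagUE.
rewrite -sumrB mulr_sumr -big_split /=; apply: eq_bigr => j _.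
by case: eqP => _ /=; rewrite ?subrr ?mulr0 ?mul0r ?addr0 ?subr0 ?mulr1 ?add0r //
  mulrCA mulrA.
Qed.

End Diag.

(** * Reduction to eigenvalue configurations *)

Section Tensor.
Variables (R : realType) (D : nat).
Local Notation C := R[i].
Implicit Types (lam g : 'I_D -> R).

Definition perm_idx m (s : {perm 'I_m}) (z : tidx D m) : tidx D m :=
  [ffun i => z (s i)].

Lemma perm_idxK m (s : {perm 'I_m}) : cancel (perm_idx s) (perm_idx s^-1).
Proof. by move=> z; apply/ffunP => i; rewrite !ffunE permKV. Qed.

Lemma perm_idx_inj m (s : {perm 'I_m}) : injective (@perm_idx m s).
Proof. exact: can_inj (perm_idxK s). Qed.

Lemma perm_idxM m (s t : {perm 'I_m}) z :
  perm_idx s (perm_idx t z) = perm_idx (s * t)%g z.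
Proof. by apply/ffunP => i; rewrite !ffunE permM. Qed.

(* The operator with eigenvalues g on site k and lam on all other sites. *)
Definition site_weight m (k : 'I_m) lam g (z : tidx D m) : R :=
  \prod_i (if i == k then g (z i) else lam (z i)).

(** Averaging over the special site makes the weight symmetric in the sites. With [g = 1] it is the
    coefficient [p(z)], and with [g] the indicator of the target index it is [f(z)]. *)
Definition mean_weight m lam g (z : tidx D m) : R :=
  (m%:R)^-1 * \sum_k site_weight k lam g z.

Definition distr m (w : tidx D m -> R) := (forall z, 0 <= w z) /\ \sum_z w z = 1.

Definition sym_weight m (w : tidx D m -> R) :=
  forall (s : {perm 'I_m}) z, w (perm_idx s z) = w z.

Lemma site_weight_perm m (k : 'I_m) lam g s z :
  site_weight k lam g (perm_idx s z) = site_weight (s k) lam g z.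
Proof.
rewrite /site_weight [RHS](reindex_inj (@perm_inj _ s)).
by apply: eq_bigr => i _; rewrite ffunE (inj_eq perm_inj).
Qed.

Lemma mean_weight_perm m lam g (s : {perm 'I_m}) z :
  mean_weight lam g (perm_idx s z) = mean_weight lam g z.
Proof.
rewrite /mean_weight [in RHS](reindex_inj (@perm_inj _ s)); congr (_ * _).
by apply: eq_bigr => k _; rewrite site_weight_perm.
Qed.

(** Under a symmetric [w] the transposition of [k] and [k'] shows that all special sites give the
    same sum, which is therefore the sum for their average. *)
Lemma sum_sym_weight m (w : tidx D m -> R) (k : 'I_m) lam g : sym_weight w ->
  \sum_z w z * site_weight k lam g z = \sum_z w z * mean_weight lam g z.
Proof.
move=> sw.
have same k' : \sum_z w z * site_weight k' lam g z =
               \sum_z w z * site_weight k lam g z.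
  rewrite (reindex_inj (@perm_idx_inj _ (tperm k k'))).
  apply: eq_bigr => z _; rewrite sw site_weight_perm.
  by rewrite tpermR.
under [RHS]eq_bigr do rewrite /mean_weight mulrCA mulr_sumr.
rewrite -mulr_sumr exchange_big /=; under [X in _ * X]eq_bigr do rewrite same.
rewrite sumr_const card_ord -[X in _ * X]mulr_natl mulKf // pnatr_eq0.
(* Division by [m] is legitimate because the site [k] rules out [m = 0]. *)
by case: m k {same sw} w => [[]|].
Qed.

(** Average [w] over all permutations of the sites: [mean_weight] is invariant under them, so its
    expectation does not change. *)
Lemma symmetrize m (w : tidx D m -> R) : distr w ->
  exists w', [/\ distr w', sym_weight w' & forall lam g,
   \sum_(z : tidx D m) w' z * mean_weight lam g z =
   \sum_(z : tidx D m) w z * mean_weight lam g z].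
Proof.
case=> w0 w1; pose c : R := #|{perm 'I_m}|%:R.
have cn : c != 0 by rewrite pnatr_eq0 -lt0n; apply/card_gt0P; exists 1%g.
pose w' z := c^-1 * \sum_(s : {perm 'I_m}) w (perm_idx s z).
have avg (h : tidx D m -> R) : (forall s z, h (perm_idx s z) = h z) ->
    \sum_z w' z * h z = \sum_z w z * h z.
  move=> hs; under eq_bigr do rewrite /w' -mulrA mulr_suml.
  rewrite -mulr_sumr exchange_big /=.
  have same (s : {perm 'I_m}) : \sum_z w (perm_idx s z) * h z = \sum_z w z * h z.
    rewrite [RHS](reindex_inj (@perm_idx_inj _ s)).
    by apply: eq_bigr => z _; rewrite hs.
  under [X in _ * X]eq_bigr do rewrite same.
  by rewrite sumr_const -[X in _ * X]mulr_natl mulKf.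
exists w'; split; last by move=> lam g; apply: avg => s z; apply: mean_weight_perm.
  split=> [z|]; first by rewrite mulr_ge0 ?invr_ge0 ?ler0n ?sumr_ge0.
  by have := avg (fun=> 1) (fun _ _ => erefl); under eq_bigr do rewrite mulr1;
     under [RHS]eq_bigr do rewrite mulr1; rewrite w1.
move=> s z; congr (_ * _).
rewrite [RHS](reindex_inj (mulIg s)); apply: eq_bigr => t _.
by rewrite perm_idxM.
Qed.

Lemma prod_delta m (x y : tidx D m) :
  \prod_i ((x i == y i)%:R : C) = (x == y)%:R.
Proof.
have [-> | xy] := eqVneq x y; first by rewrite big1 // => i _; rewrite eqxx.
have [i xyi] : exists i, x i != y i.
  apply/existsP; apply: contraNT xy; rewrite negb_exists => /forallP xy.
  by apply/eqP/ffunP => i; apply/eqP; rewrite -[_ == _]negbK.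
by rewrite (bigD1 i) //= (negPf xyi) mul0r.
Qed.

(** * Product bases of a unitary, and states diagonal in them *)

Section Lift.
Variables (U : 'M[C]_D) (UU : adjmx U *m U = 1%:M).

Definition tensor_basis m (x z : tidx D m) : C := \prod_i U (x i) (z i).
Local Notation V := tensor_basis.

Lemma tensor_basis_perm m (s : {perm 'I_m}) x z :
  V (perm_idx s x) (perm_idx s z) = V x z.
Proof.
rewrite /V [RHS](reindex_inj (@perm_inj _ s)).
by apply: eq_bigr => i _; rewrite !ffunE.
Qed.

Lemma tensor_basis_orth m (z z' : tidx D m) :
  \sum_x Num.conj (V x z) * V x z' = (z == z')%:R.
Proof.
rewrite -prod_delta.
transitivity (\prod_i \sum_a Num.conj (U a (z i)) * U a (z' i)).
  rewrite bigA_distr_bigA; apply: eq_bigr => x _.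
  by rewrite /V rmorph_prod big_split.
apply: eq_bigr => i _; have /matrixP/(_ (z i) (z' i)) := UU.
by rewrite !mxE => <-; apply: eq_bigr => a _; rewrite !mxE.
Qed.

Lemma tensor_basis_complete m (x y : tidx D m) :
  \sum_z V x z * Num.conj (V y z) = (x == y)%:R.
Proof.
rewrite -prod_delta.
transitivity (\prod_i \sum_a U (x i) a * Num.conj (U (y i) a)).
  rewrite bigA_distr_bigA; apply: eq_bigr => z _.
  by rewrite /V rmorph_prod big_split.
apply: eq_bigr => i _; have /matrixP/(_ (x i) (y i)) := mulmx1C UU.
by rewrite !mxE => <-; apply: eq_bigr => a _; rewrite !mxE.
Qed.

(** Expanding the product of the one-site spectral sums gives one term per configuration [z], with
    eigenvalue [site_weight ord_max lam g z]. *)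
Lemma tensor_op_diag lam g N (x y : tidx D N.+1) :
  (\prod_(i < N) diagU U lam (x (widen_ord (leqnSn N) i))
                             (y (widen_ord (leqnSn N) i)))
    * diagU U g (x ord_max) (y ord_max) =
  \sum_z V x z * (site_weight ord_max lam g z)%:C%C * Num.conj (V y z).
Proof.
transitivity (\prod_(i < N.+1)
    diagU U (if i == ord_max then g else lam) (x i) (y i)).
  rewrite big_ord_recr /= eqxx; congr (_ * _); apply: eq_bigr => i _.
  rewrite ifF //; apply/eqP => /(congr1 val) /= E.
  by have := ltn_ord i; rewrite E ltnn.
under eq_bigr do rewrite diagUE.
rewrite bigA_distr_bigA; apply: eq_bigr => z _.
rewrite !big_split rmorph_prod /site_weight /= rmorph_prod.
by congr (_ * _ * _); apply: eq_bigr => i _; case: ifP.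
Qed.

(** The diagonal matrix element of [rho] at the product basis vector [z]. *)
Definition diag_weight m (rho : top R D m) (z : tidx D m) : C :=
  \sum_x \sum_y Num.conj (V x z) * rho x y * V y z.

Lemma trace_diag m (A rho : top R D m) (a : tidx D m -> C) :
  (forall x y, A x y = \sum_z V x z * a z * Num.conj (V y z)) ->
  ttrace (tmul A rho) = \sum_z a z * diag_weight rho z.
Proof.
move=> AE; rewrite /ttrace /tmul /diag_weight.
under [RHS]eq_bigr do rewrite mulr_sumr.
rewrite [RHS]exchange_big /= exchange_big /=; apply: eq_bigr => y _.
under [RHS]eq_bigr do rewrite mulr_sumr.
rewrite [RHS]exchange_big /=; apply: eq_bigr => x _.
rewrite AE mulr_suml; apply: eq_bigr => z _.
by rewrite -!mulrA mulrC -!mulrA; congr (_ * _); rewrite mulrC -mulrA.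
Qed.

(** Splits a sesquilinear form of a mixture into products of overlaps; it serves both the diagonal
    and the positivity of [diag_state]. *)
Lemma sum_sesqui m (a b c : tidx D m -> C) (V' W : tidx D m -> tidx D m -> C) :
  \sum_x \sum_y a x * (\sum_z c z * (V' x z * W y z)) * b y =
  \sum_z c z * ((\sum_x a x * V' x z) * (\sum_y W y z * b y)).
Proof.
under [RHS]eq_bigr do rewrite mulr_suml mulr_sumr.
rewrite [RHS]exchange_big /=; apply: eq_bigr => x _.
under [RHS]eq_bigr do rewrite mulr_sumr mulr_sumr.
rewrite [RHS]exchange_big /=; apply: eq_bigr => y _.
rewrite mulr_sumr mulr_suml; apply: eq_bigr => z _.
by rewrite mulrCA -!mulrA.
Qed.

Definition diag_state m (w : tidx D m -> R) : top R D m :=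
  fun x y => \sum_z (w z)%:C%C * (V x z * Num.conj (V y z)).

Lemma diag_weight_state m (w : tidx D m -> R) z :
  diag_weight (diag_state w) z = (w z)%:C%C.
Proof.
rewrite /diag_weight /diag_state
  (sum_sesqui _ _ _ (@V m) (fun y z => Num.conj (V y z))).
rewrite (bigD1 z) //= !tensor_basis_orth eqxx !mulr1 big1 ?addr0 // => z' nz.
by rewrite !tensor_basis_orth (negPf nz) !mulr0.
Qed.

Lemma diag_state_density m (w : tidx D m -> R) : distr w ->
  density_op (diag_state w).
Proof.
move=> [w0 w1]; split=> [x y|v|].
- rewrite /diag_state rmorph_sum; apply: eq_bigr => z _.
  rewrite !rmorphM /= conjCK [X in _ = _ * X]mulrC; congr (_ * _).
  exact/esym/conjc_real.
- rewrite /diag_state (sum_sesqui _ _ _ (@V m) (fun y z => Num.conj (V y z))).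
  apply: sumr_ge0 => z _; rewrite mulr_ge0 ?ler0c //.
  (* The two overlaps are conjugate, so the configuration [z] contributes [w z] times the squared
     modulus of [S]. *)
  set S := \sum_y _ * v y; suff -> : \sum_x Num.conj (v x) * V x z = Num.conj S.
    by rewrite mulrC mul_conjC_ge0.
  by rewrite rmorph_sum; apply: eq_bigr => x _; rewrite rmorphM /= conjCK mulrC.
- rewrite /ttrace /diag_state exchange_big /=.
  rewrite -[1]/(1%:C%C) -w1 rmorph_sum; apply: eq_bigr => z _ /=.
  rewrite -mulr_sumr -[RHS]mulr1; congr (_ * _).
  have := tensor_basis_orth z z; rewrite eqxx => E; rewrite -[RHS]/(true%:R) -E.
  by apply: eq_bigr => x _; rewrite mulrC.
Qed.

Lemma diag_state_perm m (w : tidx D m -> R) : sym_weight w ->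
  perm_invariant (diag_state w).
Proof.
move=> sw s x y; rewrite /diag_state -/(perm_idx s x) -/(perm_idx s y).
rewrite (reindex_inj (@perm_idx_inj _ s)); apply: eq_bigr => z _.
by rewrite sw !tensor_basis_perm.
Qed.

(** Positivity of [rho] at the basis vectors makes the diagonal nonnegative, hence real. *)
Lemma diag_weight_distr m (rho : top R D m) : density_op rho ->
  exists2 w, distr w & forall z, diag_weight rho z = (w z)%:C%C.
Proof.
move=> [_ rho0 rho1].
have d0 z : 0 <= diag_weight rho z by exact: rho0.
have dE z : diag_weight rho z = (complex.Re (diag_weight rho z))%:C%C.
  by rewrite RRe_real // ger0_real.
exists (fun z => complex.Re (diag_weight rho z)) => //.
split=> [z|]; first by rewrite -ler0c -dE.
apply: (@complexI R); rewrite rmorph_sum; under eq_bigr do rewrite /= -dE.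
rewrite -[RHS]rho1.
(* The total weight is the trace of the identity times [rho]; by completeness the identity is
   diagonal in the product basis with all eigenvalues 1. *)
rewrite -(eq_bigr _ (fun z _ => mul1r (diag_weight rho z))).
rewrite -(@trace_diag _ (fun x y => (x == y)%:R)) => [|x y]; last first.
  by rewrite -tensor_basis_complete; apply: eq_bigr => z _; rewrite mulr1.
rewrite /ttrace /tmul; apply: eq_bigr => x _.
rewrite (bigD1 x) //= eqxx mul1r big1 ?addr0 // => y yx.
by rewrite eq_sym (negPf yx) mul0r.
Qed.

Lemma diag_weight_perm m (rho : top R D m) s z : perm_invariant rho ->
  diag_weight rho (perm_idx s z) = diag_weight rho z.
Proof.
move=> sr; rewrite /diag_weight (reindex_inj (@perm_idx_inj _ s)).
apply: eq_bigr => x _; rewrite (reindex_inj (@perm_idx_inj _ s)).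
by apply: eq_bigr => y _; rewrite !tensor_basis_perm sr.
Qed.

(** Permutation invariance of [rho] makes [w] symmetric, so the distinguished last site may be
    replaced by the average over all sites. *)
Lemma trace_tensor_op lam g N (A rho : top R D N.+1) w :
  (forall x y, A x y =
    (\prod_(i < N) diagU U lam (x (widen_ord (leqnSn N) i))
                               (y (widen_ord (leqnSn N) i)))
    * diagU U g (x ord_max) (y ord_max)) ->
  perm_invariant rho -> (forall z, diag_weight rho z = (w z)%:C%C) ->
  ttrace (tmul A rho) = (\sum_z w z * mean_weight lam g z)%:C%C.
Proof.
move=> AE sr rw; rewrite -(@sum_sym_weight _ w ord_max) => [|s z]; last first.
  by apply: (@complexI R); rewrite /= -!rw diag_weight_perm.
rewrite (@trace_diag _ _ _ (fun z => (site_weight ord_max lam g z)%:C%C)) => [|x y].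
  by rewrite rmorph_sum; apply: eq_bigr => z _; rewrite rw rmorphM mulrC.
by rewrite AE tensor_op_diag.
Qed.

End Lift.

Definition attainable lam i0 N (p f : R) :=
  exists w : tidx D N.+1 -> R,
    [/\ distr w, p = \sum_z w z * mean_weight lam (fun=> 1) z &
        f = \sum_z w z * mean_weight lam (fun j => (j == i0)%:R) z].

(** * From permutation-invariant states to attainable pairs and back *)

Section States.
Variables (U Omega : 'M[C]_D) (Psi : 'cV[C]_D) (lam : 'I_D -> R) (i0 : 'I_D).
Hypothesis UU : adjmx U *m U = 1%:M.
Hypothesis OE : Omega = diagU U lam.
Hypothesis PE : proj Psi = diagU U (fun j => (j == i0)%:R).

Lemma p_rho_diag N (rho : top R D N.+1) w :
  perm_invariant rho -> (forall z, diag_weight U rho z = (w z)%:C%C) ->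
  p_rho Omega rho = (\sum_z w z * mean_weight lam (fun=> 1) z)%:C%C.
Proof.
apply: trace_tensor_op => // x y.
by rewrite /test_op OE (diagU_idmx (mulmx1C UU)) [1%:M _ _]mxE.
Qed.

Lemma f_rho_diag N (rho : top R D N.+1) w :
  perm_invariant rho -> (forall z, diag_weight U rho z = (w z)%:C%C) ->
  f_rho Omega Psi rho =
    (\sum_z w z * mean_weight lam (fun j => (j == i0)%:R) z)%:C%C.
Proof. by apply: trace_tensor_op => // x y; rewrite /fid_op OE PE. Qed.

Lemma attainable_state N p f : attainable lam i0 N p f ->
  exists rho : top R D N.+1,
    [/\ density_op rho, perm_invariant rho, p_rho Omega rho = p%:C%C &
        f_rho Omega Psi rho = f%:C%C].
Proof.
move=> [w [dw -> ->]]; have [w' [dw' sw' wE]] := symmetrize dw.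
have sr := diag_state_perm U sw'.
have rE z := diag_weight_state UU w' z.
exists (diag_state U w'); split; rewrite -?wE //.
- exact: diag_state_density.
- exact: p_rho_diag.
- exact: f_rho_diag.
Qed.

Lemma state_attainable N (rho : top R D N.+1) :
  density_op rho -> perm_invariant rho ->
  exists p f, [/\ attainable lam i0 N p f, p_rho Omega rho = p%:C%C &
                  f_rho Omega Psi rho = f%:C%C].
Proof.
move=> dr sr; have [w dw wE] := diag_weight_distr UU dr.
eexists; eexists; split; last 2 first.
- exact: p_rho_diag wE.
- exact: f_rho_diag wE.
by exists w.
Qed.

(** The ratios [f / p] are bounded below by 0 and form a nonempty set, so a lower bound on the
    infimum amounts to a linear inequality for every attainable pair with [delta <= p]. *)
Lemma Fmin_geP N F delta :
  (forall j, 0 <= lam j) -> lam i0 = 1 -> 0 < delta <= 1 ->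
  F <= Fmin N delta Omega Psi <->
  (forall p f, attainable lam i0 N p f -> delta <= p -> F * p <= f).
Proof.
move=> lam0 lami0 /andP[d0 d1].
have mw0 g z : (forall j, 0 <= g j) -> 0 <= mean_weight lam g z :> R.
  move=> g0; rewrite mulr_ge0 ?invr_ge0 ?ler0n ?sumr_ge0 // => k _.
  by apply: prodr_ge0 => i _; case: ifP.
pose S := [set r : R | exists rho : top R D N.+1,
         [/\ density_op rho, perm_invariant rho,
             (delta%:C)%C <= p_rho Omega rho &
             r = complex.Re (f_rho Omega Psi rho / p_rho Omega rho)]]%classic.
have SE r : S r <-> exists p f, [/\ attainable lam i0 N p f, delta <= p & r = f / p].
  split=> [[rho [dr sr dp ->]]|[p [f [/attainable_state[rho [dr sr pE fE]] dp ->]]]].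
    have [p [f [apf pE fE]]] := state_attainable dr sr.
    exists p, f; split=> //; first by rewrite -lecR -pE.
    by rewrite pE fE -fmorph_div.
  exists rho; split=> //; first by rewrite pE lecR.
  by rewrite pE fE -fmorph_div.
rewrite /Fmin -/S; split=> [FS p f apf dp|H].
  have pp : 0 < p by apply: lt_le_trans dp.
  rewrite -ler_pdivlMr // (le_trans FS) //; apply: ge_inf.
    exists 0 => r /SE[p' [f' [[w [[w0 _] -> ->]] _ ->]]].
    by rewrite divr_ge0 // sumr_ge0 // => z _; rewrite mulr_ge0 ?mw0.
  by apply/SE; exists p, f.
apply: lb_le_inf => [|r /SE[p [f [apf dp ->]]]]; last first.
  by rewrite ler_pdivlMr ?H // (lt_le_trans d0).
(* For nonemptiness: with the target state at all sites, [p = f = 1], which is admissible as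
   [delta <= 1]. *)
pose z0 : tidx D N.+1 := [ffun=> i0].
pose w z : R := (z == z0)%:R.
have wE h : \sum_z w z * h z = h z0.
  rewrite (bigD1 z0) //= /w eqxx mul1r big1 ?addr0 // => z nz.
  by rewrite (negPf nz) mul0r.
have m1 g : g i0 = 1 -> mean_weight lam g z0 = 1.
  move=> gi0; rewrite /mean_weight (eq_bigr (fun=> 1)) => [|k _].
    by rewrite sumr_const card_ord mulVf // pnatr_eq0.
  by rewrite /site_weight big1 // => i _; rewrite ffunE; case: ifP.
exists (1 / 1); apply/SE; exists 1, 1; split=> //.
exists w; rewrite !wE !m1 ?eqxx //; split=> //; split=> [z|].
  by rewrite ler0n.
by under eq_bigr do rewrite -[w _]mulr1; rewrite wE.
Qed.

End States.

End Tensor.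

(** * Attainable pairs and the lower bound *)

Section Attainable.
Variables (R : realType) (D : nat).
Implicit Types lam g : 'I_D -> R.

Lemma attainable_point lam (i0 : 'I_D) N (z : tidx D N.+1) :
  attainable lam i0 N (mean_weight lam (fun=> 1) z)
                      (mean_weight lam (fun j => (j == i0)%:R) z).
Proof.
have wE h : \sum_x (x == z)%:R * h x = h z :> R.
  rewrite (bigD1 z) //= eqxx mul1r big1 ?addr0 // => x nx.
  by rewrite (negPf nx) mul0r.
exists (fun x => (x == z)%:R); rewrite !wE; split=> //; split=> [x|].
  by rewrite ler0n.
by under eq_bigr do rewrite -[_%:R]mulr1; rewrite (wE (fun=> 1)).
Qed.

Lemma attainable_mix lam i0 N (q p f p' f' : R) : 0 <= q <= 1 ->
  attainable lam i0 N p f -> attainable lam i0 N p' f' ->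
  attainable lam i0 N (q * p + (1 - q) * p') (q * f + (1 - q) * f').
Proof.
move=> /andP[q0 q1] [w [[w0 w1] -> ->]] [w' [[w0' w1'] -> ->]].
have wE h : \sum_z (q * w z + (1 - q) * w' z) * h z =
    q * (\sum_z w z * h z) + (1 - q) * (\sum_z w' z * h z).
  rewrite !mulr_sumr -big_split; apply: eq_bigr => z _ /=.
  by rewrite mulrDl !mulrA.
exists (fun z => q * w z + (1 - q) * w' z); rewrite !wE; split=> //; split=> [z|].
  by rewrite addr_ge0 // mulr_ge0 // subr_ge0.
by rewrite big_split -!mulr_sumr /= w1 w1' !mulr1 addrC subrK.
Qed.

(** Push the distribution forward along [phi], which relabels every non-target site to [j]; the
    weights for [lam] at [phi z] are the homogeneous weights at [z]. *)
Lemma attainable_homog lam i0 j N p f : lam i0 = 1 -> j != i0 ->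
  attainable (fun i => if i == i0 then 1 else lam j) i0 N p f ->
  attainable lam i0 N p f.
Proof.
move=> lami0 ji [w [[w0 w1] -> ->]].
pose phi (z : tidx D N.+1) : tidx D N.+1 :=
  [ffun i => if z i == i0 then i0 else j].
pose w' y := \sum_(z | phi z == y) w z.
have wE h : \sum_y w' y * h y = \sum_z w z * h (phi z).
  rewrite [RHS](partition_big phi predT) //=; apply: eq_bigr => y _.
  by rewrite /w' mulr_suml; apply: eq_bigr => z /eqP ->.
have mE (g : bool -> R) z : mean_weight lam (fun i => g (i == i0)) (phi z) =
  mean_weight (fun i => if i == i0 then 1 else lam j) (fun i => g (i == i0)) z.
  congr (_ * _); apply: eq_bigr => k _; apply: eq_bigr => i _.
  rewrite ffunE; case: (z i == i0); rewrite ?eqxx ?lami0 //.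
  by rewrite (negPf ji).
exists w'; split.
- split=> [z|]; first exact: sumr_ge0.
  have := wE (fun=> 1); under eq_bigr do rewrite mulr1; move=> ->.
  by under eq_bigr do rewrite mulr1.
- by rewrite wE; apply: eq_bigr => z _; rewrite (mE (fun=> 1)).
- by rewrite wE; apply: eq_bigr => z _; rewrite (mE (fun b => b%:R)).
Qed.

Lemma mean_weightE lam g m (z : tidx D m) : (forall j, lam j != 0) ->
  mean_weight lam g z =
  (m%:R)^-1 * ((\prod_i lam (z i)) * \sum_k g (z k) / lam (z k)).
Proof.
move=> ln0; congr (_ * _); rewrite mulr_sumr; apply: eq_bigr => k _.
rewrite /site_weight (bigD1 k) //= eqxx [in RHS](bigD1 k) //=.
rewrite [X in _ * X](eq_bigr (fun i => lam (z i))) => [|i /negPf -> //].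
by set Q := \prod_(i | _) _; field; exact: ln0.
Qed.

(** The pure configuration with [j] at the first [t] sites and the target at the rest; the closed
    forms come from [mean_weightE]. *)
Lemma attainable_type lam i0 j N t : lam i0 = 1 -> j != i0 ->
  (forall i, lam i != 0) -> (t <= N.+1)%N ->
  attainable lam i0 N
    (lam j ^+ t * (t%:R / lam j + (N.+1 - t)%:R) / N.+1%:R)
    (lam j ^+ t * (N.+1 - t)%:R / N.+1%:R).
Proof.
move=> lami0 ji ln0 tN.
pose z : tidx D N.+1 := [ffun i : 'I_N.+1 => if (i < t)%N then j else i0].
have prodE : \prod_(i < N.+1) lam (z i) = lam j ^+ t.
  under eq_bigr do rewrite ffunE.
  rewrite -(big_mkord xpredT (fun i : nat => lam (if (i < t)%N then j else i0))).
  rewrite (big_cat_nat (n := t)) //=.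
  rewrite (eq_big_nat _ _ (F2 := fun=> lam j)) => [|i /andP[_ ->] //].
  rewrite [X in _ * X](eq_big_nat _ _ (F2 := fun=> 1)) => [|i /andP[ti _]].
    by rewrite !prodr_const_nat subn0 expr1n mulr1.
  by rewrite ltnNge ti.
have sumE g : \sum_(k < N.+1) g (z k) / lam (z k) =
    t%:R * (g j / lam j) + (N.+1 - t)%:R * g i0.
  under eq_bigr do rewrite ffunE.
  rewrite -(big_mkord xpredT (fun i : nat =>
    g (if (i < t)%N then j else i0) / lam (if (i < t)%N then j else i0))).
  rewrite (big_cat_nat (n := t)) //=; congr (_ + _).
    rewrite (eq_big_nat _ _ (F2 := fun=> g j / lam j)) => [|i /andP[_ ->] //].
    by rewrite sumr_const_nat subn0 mulr_natl.
  rewrite (eq_big_nat _ _ (F2 := fun=> g i0)) => [|i /andP[ti _]].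
    by rewrite sumr_const_nat mulr_natl.
  by rewrite ltnNge ti lami0 divr1.
have := attainable_point lam i0 z.
rewrite !mean_weightE // prodE (sumE (fun=> 1)) (sumE (fun i => (i == i0)%:R)) /=.
rewrite eqxx (negPf ji) mul0r mulr0 add0r !mulr1.
by rewrite !mul1r ![(N.+1%:R)^-1 * _]mulrC.
Qed.

(* If N < k, the configuration without any target site has f = 0.  Otherwise
   mix k and k + 1 non-target sites with weights q and 1 - q, where
   q = lam M / (lam M + k) and M = N - k: then p = lam^k and f = q lam^k. *)
Lemma homog_lower_bound lam i0 j N k (eps delta : R) : lam i0 = 1 -> j != i0 ->
  (forall i, 0 < lam i) -> lam j <= 1 -> 0 < eps < 1 -> 
  (0 < k)%N -> delta <= lam j ^+ k ->
  (forall p f, attainable lam i0 N p f -> delta <= p -> (1 - eps) * p <= f) ->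
  k%:R + k%:R * (1 - eps) / (lam j * eps) <= N%:R.
Proof.
move=> lami0 ji lam0 lx1 /andP[e0 e1] k0 dk H.
set x := lam j in lx1 dk *; have x0 : 0 < x by exact: lam0.
have ln0 i : lam i != 0 by rewrite gt_eqF.
have kp : 0 < k%:R :> R by rewrite ltr0n.
have Np : 0 < N.+1%:R :> R by rewrite ltr0n.
case: (leqP k N) => kN; last first.
  have := H _ _ (attainable_type lami0 ji ln0 (leqnn N.+1)).
  rewrite subnn addr0 !mulr0 mul0r -/x.
  have -> : x ^+ N.+1 * (N.+1%:R / x) / N.+1%:R = x ^+ N.
    by rewrite exprS; field; rewrite nat1r !gt_eqF.
  have -> : delta <= x ^+ N.
    by rewrite (le_trans dk) // ler_wiXn2l // ?ltW // ltnW.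
  by move=> /(_ isT); rewrite pmulr_rle0 ?subr_gt0 // leNgt exprn_gt0.
pose M : R := (N - k)%:R.
have M0 : 0 <= M by rewrite ler0n.
have NE : N%:R = k%:R + M by rewrite -natrD subnKC.
have dp : 0 < x * M + k%:R by rewrite ltr_wpDl // mulr_ge0 // ltW.
pose q := x * M / (x * M + k%:R).
have q01 : 0 <= q <= 1.
  rewrite divr_ge0 ?mulr_ge0 ?(ltW x0) ?(ltW dp) //=.
  by rewrite ler_pdivrMr // mul1r lerDl ltW.
have a1 := attainable_type lami0 ji ln0 (leqW kN).
have a2 := attainable_type lami0 ji ln0 (kN : k.+1 <= N.+1)%N.
have := H _ _ (attainable_mix q01 a1 a2).
rewrite subSS subSn // -/M -/x.
have E1 : (N.+1)%:R = k%:R + M + 1 by rewrite -NE natr1.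
have E2 : (N - k).+1%:R = M + 1 by rewrite -natr1.
have kM : k%:R + M + 1 != 0 by rewrite -E1 gt_eqF.
rewrite E1 E2 -[k.+1%:R]natr1 exprS.
set P := q * _ + _; have -> : P = x ^+ k.
  by rewrite /P /q; field; rewrite kM !gt_eqF.
set f := q * _ + _; have -> : f = q * x ^+ k.
  by rewrite /f /q; field; rewrite kM !gt_eqF.
move=> /(_ dk); rewrite ler_pM2r ?exprn_gt0 // ler_pdivlMr // => Hq.
(* Cancelling [x ^+ k] has left [F * (x * M + k) <= x * M], that is [F * k <= eps * x * M]. *)
rewrite NE lerD2l ler_pdivrMr ?mulr_gt0 //.
by move: Hq; nra.
Qed.

End Attainable.

(** * The upper bounds *)

Section RealLemmas.
Variable R : realType.
Implicit Types (x y : R).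

Lemma ln_leB1 x : 0 < x -> ln x <= x - 1.
Proof. by move=> x0; rewrite -{1}[x](subrKC 1) le_ln1Dx //; lra. Qed.

Lemma lnV_gt0 x : 0 < x < 1 -> 0 < ln x^-1.
Proof. by move=> /andP[x0 x1]; rewrite ln_gt0 // invf_gt1. Qed.

Lemma ln_prod (I : finType) (F : I -> R) : (forall i, 0 < F i) ->
  ln (\prod_i F i) = \sum_i ln (F i).
Proof.
move=> F0; suff [] : 0 < \prod_i F i /\ ln (\prod_i F i) = \sum_i ln (F i) by [].
elim/big_rec2: _ => [|i s p _ [p0 <-]]; first by rewrite ln1.
by rewrite mulr_gt0 // lnM ?posrE.
Qed.

(* -y ln y is concave, hence lies below its tangent at x. *)
Lemma xlnV_tangent x y : 0 < x -> 0 < y ->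
  y * ln y^-1 <= x * ln x^-1 + (y - x) * (- ln x - 1).
Proof.
move=> x0 y0; rewrite !lnV ?posrE //.
have := ln_leB1 (divr_gt0 x0 y0); rewrite ln_div ?posrE // => H.
have : y * (ln x - ln y) <= y * (x / y - 1) by rewrite ler_pM2l.
by rewrite !mulrBr mulr1 [y * (_ / _)]mulrCA mulfV ?gt_eqF // mulr1; lra.
Qed.

(** A concave function on an interval is smallest at an endpoint: the sign of the tangent slope at
    [x] decides whether [tau] or [beta] lies no higher. *)
Lemma xlnV_min x (tau beta : R) : 0 < tau -> tau <= x <= beta ->
  Order.min (beta * ln beta^-1) (tau * ln tau^-1) <= x * ln x^-1.
Proof.
move=> t0 /andP[tx xb]; have x0 := lt_le_trans t0 tx.
rewrite ge_min; have [d0|d0] := leP 0 (- ln x - 1).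
  apply/orP; right; apply: le_trans (xlnV_tangent x0 t0) _.
  by rewrite gerDl mulr_le0_ge0 // subr_le0.
apply/orP; left; apply: le_trans (xlnV_tangent x0 (lt_le_trans x0 xb)) _.
by rewrite gerDl mulr_ge0_le0 ?subr_ge0 // ltW.
Qed.

End RealLemmas.

(** * Fidelity bounds at a fixed [N], with [b] for [ln beta^-1] and [N_large] cleared of
    denominators *)

Section Upper.
Variables (R : realType) (D : nat) (lam : 'I_D -> R) (i0 : 'I_D).
Variables (eps h b L d : R) (N : nat).
Hypothesis lami0 : lam i0 = 1.
Hypothesis lam0 : forall i, 0 < lam i.
Hypothesis eps01 : 0 < eps < 1.
Hypothesis b_gt0 : 0 < b.
Hypothesis lam_b : forall i, i != i0 -> b <= - ln (lam i).
Hypothesis lam_h : forall i, i != i0 -> (lam i)^-1 <= h * - ln (lam i).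
Hypothesis d0 : 0 < d.
Hypothesis L_def : L = - ln d.
Hypothesis L_gt0 : 0 < L.
Hypothesis N_large : L * (eps / b + (1 - eps) * h) <= eps * N.+1%:R.

Let Lam (z : tidx D N.+1) := \prod_i lam (z i).
Let pz (z : tidx D N.+1) := mean_weight lam (fun=> 1) z.
Let fz (z : tidx D N.+1) := mean_weight lam (fun j => (j == i0)%:R) z.

Let Lam0 z : 0 < Lam z. Proof. exact: prodr_gt0. Qed.
Let lam_neq0 i : lam i != 0. Proof. by rewrite gt_eqF. Qed.
Let sumc (c : R) : \sum_(k < N.+1) c = c * N.+1%:R.
Proof. by rewrite sumr_const card_ord mulr_natr. Qed.
Let N0 : 0 < N.+1%:R :> R. Proof. by rewrite ltr0n. Qed.

(* Site k contributes ([z k = 0] - F)/lam >= eps + (eps/b + F h) ln lam to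
   T (f - F p)/Lam; the remaining estimate in Lam is ln x <= x - 1 at x = d/Lam. *)
Lemma type_bound z : eps * (Lam z - d) <= L * (fz z - (1 - eps) * pz z).
Proof.
have /andP[e0 e1] := eps01; pose c := eps / b + (1 - eps) * h.
have site i : eps + c * ln (lam i) <=
    ((i == i0)%:R - (1 - eps)) / lam i.
  have [->|ii] := eqVneq i i0.
    by rewrite lami0 ln1 mulr0 divr1 /=; lra.
  have := lam_b ii; have := lam_h ii; set a := - ln (lam i) => ha ba.
  have -> : ln (lam i) = - a by rewrite opprK.
  have h1 : eps <= eps / b * a.
    by rewrite mulrAC ler_pdivlMr // ler_pM2l.
  have h2 : (1 - eps) * (lam i)^-1 <= (1 - eps) * (h * a).
    by rewrite ler_pM2l // subr_gt0.
  by rewrite /c /= sub0r mulNr; lra.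
have sumE : \sum_k ((z k == i0)%:R - (1 - eps)) / lam (z k) =
   \sum_k (z k == i0)%:R / lam (z k) - (1 - eps) * \sum_k 1 / lam (z k).
  rewrite mulr_sumr -sumrB; apply: eq_bigr => k _.
  by rewrite mulrBl mul1r.
have dE : fz z - (1 - eps) * pz z =
   Lam z * (\sum_k ((z k == i0)%:R - (1 - eps)) / lam (z k)) / N.+1%:R.
  by rewrite /fz /pz !mean_weightE // sumE -/(Lam z); field; rewrite nat1r gt_eqF.
have lnLam : ln (Lam z) = \sum_i ln (lam (z i)) by rewrite ln_prod.
have low : eps * N.+1%:R + c * ln (Lam z) <=
    \sum_k ((z k == i0)%:R - (1 - eps)) / lam (z k).
  rewrite lnLam mulr_sumr -sumc -big_split.
  by apply: ler_sum => k _; apply: site.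
have ln_le0' : ln (Lam z) <= 0.
  rewrite lnLam sumr_le0 // => i _.
  have [->|ii] := eqVneq (z i) i0; first by rewrite lami0 ln1.
  by rewrite -oppr_ge0 (le_trans (ltW b_gt0)) ?lam_b.
have key : eps * (L + ln (Lam z)) <=
   L * (\sum_k ((z k == i0)%:R - (1 - eps)) / lam (z k)) / N.+1%:R.
  rewrite ler_pdivlMr //; apply: le_trans (ler_wpM2l (ltW L_gt0) low).
  (* The size condition on [N] enters here, multiplied by the nonpositive [ln (Lam z)]. *)
  have : eps * N.+1%:R * ln (Lam z) <= L * c * ln (Lam z).
    exact: (ler_wnM2r ln_le0' N_large).
  by lra.
have tan : Lam z - d <= Lam z * (L + ln (Lam z)).
  have := ln_leB1 (divr_gt0 d0 (Lam0 z)); rewrite ln_div ?posrE // => H.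
  have := ler_wpM2l (ltW (Lam0 z)) H.
  rewrite L_def mulrBr mulrBr mulr1 mulrCA divff ?gt_eqF //; lra.
rewrite dE; apply: le_trans (_ : Lam z * (eps * (L + ln (Lam z))) <= _).
  by rewrite mulrCA ler_pM2l.
by rewrite [L * _]mulrA [L * _]mulrCA -mulrA ler_pM2l // mulrA.
Qed.

Lemma sum_distr_const (w : tidx D N.+1 -> R) (c : R) : distr w ->
  \sum_z w z * c = c.
Proof. by case=> _ w1; rewrite -mulr_suml w1 mul1r. Qed.

(** Averaging [type_bound] with [f <= Lam] gives [eps * (f - F * delta) <= L * (f - F * p)]. Since
    [delta <= p], it follows that [(L - eps) * (f - F * p) >= 0]. *)
Lemma fidelity_bound_F delta p f : d = (1 - eps) * delta -> eps < L ->
  attainable lam i0 N p f -> delta <= p -> (1 - eps) * p <= f.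
Proof.
move=> dE eL [w [dw -> ->]] dp; have /andP[e0 e1] := eps01.
have fLam z : fz z <= Lam z.
  rewrite /fz mean_weightE // -/(Lam z) mulrCA ger_pMr // mulrC ler_pdivrMr // mul1r.
  rewrite -[X in _ <= X]mul1r -sumc; apply: ler_sum => k _.
  by case: eqP => [->|_]; rewrite ?lami0 ?divr1 // mul0r.
set P := \sum_z w z * _ in dp *; set Q := \sum_z _.
have : eps * (Q - d) <= L * (Q - (1 - eps) * P).
  rewrite -{1}(sum_distr_const d dw) /P /Q mulr_sumr -!sumrB !mulr_sumr.
  apply: ler_sum => z _; have w0 := dw.1 z.
  have := ler_wpM2l w0 (type_bound z).
  have := ler_wpM2l w0 (ler_wpM2l (ltW e0) (fLam z)).
  rewrite -/(pz z) -/(fz z); lra.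
rewrite dE => H; rewrite -subr_ge0.
have : 0 <= (L - eps) * (Q - (1 - eps) * P).
  by have := ler_wpM2l (ltW e0) (ler_wpM2l (_ : 0 <= 1 - eps) dp); lra.
by rewrite pmulr_rge0 // subr_gt0.
Qed.

(** Averaging [type_bound] with [tau * p <= Lam] gives [eps * tau * (p - delta) <= L * (f - F * p)],
    whose left side is nonnegative. *)
Lemma fidelity_bound_tau tau delta p f : 0 < tau ->
  (forall i, tau <= lam i) -> d = tau * delta ->
  attainable lam i0 N p f -> delta <= p -> (1 - eps) * p <= f.
Proof.
move=> t0 lamt dE [w [dw -> ->]] dp; have /andP[e0 e1] := eps01.
have pLam z : tau * pz z <= Lam z.
  rewrite /pz mean_weightE // -/(Lam z) mulrCA [tau * _]mulrCA mulrCA ger_pMr //.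
  rewrite mulrC ler_pdivrMr // mul1r.
  rewrite -[X in _ <= X]mul1r -sumc mulr_sumr.
  by apply: ler_sum => k _; rewrite mul1r ler_pdivrMr // mul1r.
set P := \sum_z w z * _ in dp *; set Q := \sum_z _.
have : eps * (tau * P - d) <= L * (Q - (1 - eps) * P).
  rewrite -{1}(sum_distr_const d dw) /P /Q !mulr_sumr -!sumrB !mulr_sumr.
  apply: ler_sum => z _; have w0 := dw.1 z.
  have := ler_wpM2l w0 (type_bound z).
  have := ler_wpM2l w0 (ler_wpM2l (ltW e0) (pLam z)).
  rewrite -/(pz z) -/(fz z); lra.
rewrite dE -mulrBr => H; rewrite -subr_ge0.
have : 0 <= L * (Q - (1 - eps) * P).
  by apply: le_trans H; rewrite !mulr_ge0 ?subr_ge0 // ltW.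
by rewrite pmulr_rge0.
Qed.

End Upper.

(** * Integer rounding of the bounds *)

Section Bounds.
Variable R : realType.
Implicit Types (eps delta beta h b L X : R).

(** The floor is the largest [k] with [delta <= x ^+ k], because [ln x < 0]. As [N - k] is an
    integer, the real bound passes to the ceiling. *)
Lemma kminus_le x delta r (N : nat) : 0 < x < 1 -> 0 < delta < 1 ->
  (forall k : nat, (0 < k)%N -> delta <= x ^+ k -> k%:R + k%:R * r <= N%:R :> R) ->
  kminus delta x + Num.ceil ((kminus delta x)%:~R * r) <= N%:Z.
Proof.
move=> /andP[x0 x1] /andP[d0 d1] H.
have lx : ln x < 0 by rewrite ln_lt0 // x0.
have ld : ln delta < 0 by rewrite ln_lt0 // d0.
have k0 : 0 <= kminus delta x.
  by rewrite /kminus floor_ge0 -mulrNN -invrN divr_ge0 // oppr_ge0 ltW.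
have kE : kminus delta x = (absz (kminus delta x))%:Z by rewrite gez0_abs.
have kd : (kminus delta x)%:~R <= ln delta / ln x :> R by apply: floor_le.
rewrite kE in kd *; move: (absz _) kd => k; rewrite -pmulrn => kd.
(* For [k = 0] the claimed bound is 0, and the hypothesis says nothing. *)
have [->|kp] := posnP k; first by rewrite mul0r ceil0.
rewrite -lerBrDl ceil_le_int rmorphB /= -!pmulrn lerBrDl; apply: H => //.
rewrite -ler_ln ?posrE ?exprn_gt0 // lnXn // -mulr_natl.
by rewrite ler_ndivlMr // in kd.
Qed.

(** The ceiling is below its argument plus 1, which absorbs the [- 1]; then [L / b <= L * h], and
    [F / eps + 1 = 1 / eps]. *)
Lemma ceil_bound_lt eps h b L : 0 < eps -> 0 < L -> b^-1 <= h ->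
  (Num.ceil (h * (1 - eps) * L / eps + L / b - 1))%:~R < h * L / eps.
Proof.
move=> e0 L0 bh; set X := _ - 1.
have := ceilB1_lt X; rewrite rmorphB /= ltrBlDr => /lt_le_trans; apply.
have -> : h * L / eps = h * (1 - eps) * L / eps + L * h by field; rewrite gt_eqF.
by rewrite /X subrK lerD2l ler_pM2l.
Qed.

(** The [- 1] in the ceiling reflects that the condition concerns [N + 1]. A positive argument makes
    the ceiling a natural number at least 1. *)
Lemma ceil_bound_large eps h b L : 0 < eps -> 0 < b ->
  0 < h * (1 - eps) * L / eps + L / b - 1 ->
  exists N : nat, [/\ (0 < N)%N,
    N%:Z = Num.ceil (h * (1 - eps) * L / eps + L / b - 1) &
    L * (eps / b + (1 - eps) * h) <= eps * N.+1%:R].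
Proof.
move=> e0 b0; set X := _ - 1 => X0.
have cE : (absz (Num.ceil X))%:Z = Num.ceil X by rewrite gtz0_abs ?ceil_gt0.
exists (absz (Num.ceil X)); split=> //; first by rewrite absz_gt0 gt_eqF ?ceil_gt0.
have := ceil_ge X; rewrite -{1}cE -pmulrn -natr1 => HX.
have -> : L * (eps / b + (1 - eps) * h) = eps * (X + 1).
  by rewrite /X subrK; field; rewrite !gt_eqF.
by rewrite ler_pM2l // lerD2r.
Qed.

(** Replacing [h] by the smaller [(beta * b)^-1] reduces the claim to [main]. There the tangent to
    [- y ln y] at [F], evaluated at [beta], bounds [beta * b], and [eps <= - ln F < L] does the
    rest. *)
Lemma N_bound_gt0 eps delta beta h L : 0 < eps < 1 -> 0 < delta < 1 ->
  0 < beta < 1 ->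
  (beta * ln beta^-1)^-1 <= h ->
  L = - ln ((1 - eps) * delta) ->
  0 < h * (1 - eps) * L / eps + L / ln beta^-1 - 1.
Proof.
move=> /andP[e0 e1] d01 b01 hb LE; have /andP[d0 d1] := d01.
have b0 := lnV_gt0 b01; case/andP: b01 => be0 be1.
set b := ln beta^-1 in b0 hb *; pose F := 1 - eps.
have F0 : 0 < F by rewrite subr_gt0.
have eF : eps <= - ln F by have := ln_leB1 F0; rewrite /F; lra.
have lL : - ln F < L.
  by rewrite LE lnM ?posrE // opprD ltrDl oppr_gt0 ln_lt0 // d0.
have L0 : 0 < L by apply: lt_trans lL; apply: lt_le_trans eF.
have bF : beta * b <= beta * - ln F + F.
  have := xlnV_tangent F0 be0; rewrite -/b lnV ?posrE //; move: (ln F) => l; lra.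
have main : eps * (beta * b) < L * (beta * eps + F).
  apply: le_lt_trans (ler_wpM2l (ltW e0) bF) _.
  apply: le_lt_trans (_ : - ln F * (beta * eps + F) < _).
    by have := ler_wpM2r (ltW F0) eF; lra.
  by rewrite ltr_pM2r // addr_gt0 // mulr_gt0.
rewrite subr_gt0 -/F.
apply: lt_le_trans (_ : (beta * b)^-1 * F * L / eps + L / b <= _).
  have -> : (beta * b)^-1 * F * L / eps + L / b =
      L * (beta * eps + F) / (eps * (beta * b)) by field; rewrite !gt_eqF.
  by rewrite ltr_pdivlMr ?mulr_gt0 // mul1r.
by rewrite lerD2r !ler_pM2r ?invr_gt0.
Qed.

End Bounds.

(* D = n.+2 >= 2; eigenvalues lam 0 = 1 > lam 1 >= ... >= lam (D-1) > 0,
   beta = lam 1 (second largest), tau = lam (D-1) (smallest). *)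
Theorem theorem6 (R : realType) (n : nat) (eps delta : R)
    (Omega : 'M[R[i]]_n.+2) (Psi : 'cV[R[i]]_n.+2) (lam : 'I_n.+2 -> R) :
  0 < eps < 1 -> 0 < delta < 1 ->
  unit_vector Psi ->
  verification_operator Omega Psi ->
  char_poly Omega = \prod_(j < n.+2) ('X - ((lam j)%:C)%C%:P) ->
  (forall i j : 'I_n.+2, (i <= j)%N -> lam j <= lam i) ->
  lam ord0 = 1 -> lam (inord 1) < 1 -> 0 < lam ord_max ->
  let F := 1 - eps in
  let beta := lam (inord 1) in
  let tau := lam ord_max in
  let h := (Order.min (beta * ln beta^-1) (tau * ln tau^-1))^-1 in
  let bt := if beta * ln beta^-1 <= tau * ln tau^-1 then beta else tau in
  let lb (x : R) := kminus delta x
                    + Num.ceil ((kminus delta x)%:~R * F / (x * eps)) in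
  exists NO : nat,
    [/\ is_Nnum eps delta Omega Psi NO,
        (forall j : 'I_n.+2, (0 < j)%N ->
           exists Nj : nat,
             [/\ is_Nnum eps delta (homog_op Psi (lam j)) Psi Nj,
                 (Nj <= NO)%N & lb (lam j) <= Nj%:Z]),
        lb bt <= NO%:Z,
        NO%:Z <= Num.ceil (h * F * ln (F * delta)^-1 / eps
                           + ln (F * delta) / ln beta - 1)
        /\ (Num.ceil (h * F * ln (F * delta)^-1 / eps
                      + ln (F * delta) / ln beta - 1))%:~R
           < h * ln (F * delta)^-1 / eps &
        NO%:Z <= Num.ceil (h * F * ln (tau * delta)^-1 / eps
                           + ln (tau * delta) / ln beta - 1)
        /\ (Num.ceil (h * F * ln (tau * delta)^-1 / eps
                      + ln (tau * delta) / ln beta - 1))%:~R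
           < h * ln (tau * delta)^-1 / eps].
Proof.
move=> e01 d01 Pu [hO _ OP _] cO dec lam01 beta1 tau0 F beta tau h bt lb.
have [[e0 e1] [d0 d1]] := (andP e01, andP d01).
have F0 : 0 < F by rewrite subr_gt0.
have lamt i : tau <= lam i by apply: dec; rewrite -ltnS.
have lam0 i : 0 < lam i by apply: lt_le_trans (lamt i).
have lamb i : i != ord0 -> lam i <= beta.
  by move=> i0; apply: dec; rewrite inordK // lt0n.
have lam_lt1 i : i != ord0 -> lam i < 1 by move=> /lamb ib; apply: le_lt_trans beta1.
have be0 : 0 < beta by apply: lam0.
have be01 : 0 < beta < 1 by rewrite be0.
pose b := ln beta^-1.
have b0 : 0 < b by apply: lnV_gt0.
have ta01 : 0 < tau < 1 by rewrite tau0 (le_lt_trans (lamt (inord 1))).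
have lV x : 0 < x -> ln x^-1 = - ln x :> R by move=> x0; rewrite lnV.
pose mn := Order.min (beta * ln beta^-1) (tau * ln tau^-1).
have mn0 : 0 < mn.
  by rewrite lt_min; apply/andP; split; apply: mulr_gt0 => //; apply: lnV_gt0.
have hbeta : (beta * b)^-1 <= h.
  by rewrite lef_pV2 ?posrE ?mulr_gt0 ?lam0 // ge_min lexx.
have hb : b^-1 <= h.
  apply: le_trans hbeta; rewrite lef_pV2 ?posrE ?mulr_gt0 ?lam0 //.
  by rewrite ger_pMl // ltW.
have lam_b i : i != ord0 -> b <= - ln (lam i).
  by move=> i0; rewrite /b lV ?lam0 // lerN2 ler_ln ?posrE ?lam0 ?lamb.
have lam_h i : i != ord0 -> (lam i)^-1 <= h * - ln (lam i).
  move=> i0; have := @xlnV_min _ (lam i) tau beta tau0.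
  rewrite lamt lamb // => /(_ isT); rewrite -/mn lV ?lam0 // => H.
  by rewrite /h -/mn mulrC ler_pdivlMr // mulrC ler_pdivrMr ?lam0 // mulrC.
have [U UU OE] := hermitian_diagonalization hO cO.
have PE : proj Psi = diagU U (fun j => (j == ord0)%:R).
  by apply: (proj_diagU UU OE OP Pu) => j j0; rewrite lt_eqF ?lam_lt1.
have d01' : 0 < delta <= 1 by rewrite d0 ltW.
have OP' N : F <= Fmin N delta Omega Psi <->
    (forall p f, attainable lam ord0 N p f -> delta <= p -> F * p <= f).
  by apply: (Fmin_geP UU OE PE) => // j; rewrite ltW ?lam0.
(* The spectrum of the homogeneous operator in the same eigenbasis [U]. *)
pose mu j (i : 'I_n.+2) := if i == ord0 then 1 else lam j.
have mu0 j i : 0 < mu j i by rewrite /mu; case: ifP.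
have HP' j N : F <= Fmin N delta (homog_op Psi (lam j)) Psi <->
    (forall p f, attainable (mu j) ord0 N p f -> delta <= p -> F * p <= f).
  apply: (Fmin_geP UU (homog_op_diagU _ UU PE) PE) => // i.
  by rewrite ltW ?mu0.
have OH j N : j != ord0 -> F <= Fmin N delta Omega Psi ->
    F <= Fmin N delta (homog_op Psi (lam j)) Psi.
  move=> j0 /OP' H; apply/HP' => p f a; apply: H.
  exact: attainable_homog a.
have lnq x : ln x / ln beta = - ln x / b.
  by rewrite /b lV ?lam0 // invrN mulrNN.
(* [- ln F >= 1 - F = eps], and [- ln delta > 0] makes it strict. *)
have FdL : eps < - ln (F * delta).
  rewrite lnM ?posrE // opprD; have := ln_leB1 F0.
  have := ln_lt0 d01; rewrite /F; move: (ln delta) (ln (1 - eps)) => u v; lra.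
have [N1 [N1p N1E N1F]] : exists N : nat, [/\ (0 < N)%N,
    N%:Z = Num.ceil (h * F * ln (F * delta)^-1 / eps + ln (F * delta) / ln beta - 1) &
    F <= Fmin N delta Omega Psi].
  rewrite lnq lV ?mulr_gt0 //.
  have [N [Np NE NL]] := ceil_bound_large e0 b0 (N_bound_gt0 e01 d01 be01 hbeta erefl).
  exists N; split=> //; apply/OP' => p f.
  apply: (@fidelity_bound_F _ _ lam ord0 eps h b _ (F * delta)) => //.
  + by rewrite mulr_gt0.
  + by apply: lt_trans FdL.
have td0 : 0 < tau * delta by rewrite mulr_gt0.
(* As [tau <= beta] and [delta < 1]. Hence [L / b > 1], so the argument of the second ceiling is
   positive. *)
have bL : b < - ln (tau * delta).
  rewrite lnM ?posrE // opprD; have := ln_lt0 d01.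
  have : b <= - ln tau by rewrite /b lV // lerN2 ler_ln ?posrE ?lamt.
  move: (ln delta) (ln tau) => u v; lra.
have [N2 [N2p N2E N2F]] : exists N : nat, [/\ (0 < N)%N,
    N%:Z = Num.ceil (h * F * ln (tau * delta)^-1 / eps + ln (tau * delta) / ln beta - 1) &
    F <= Fmin N delta Omega Psi].
  rewrite lnq lV //; have L0 := lt_trans b0 bL.
  have X0 : 0 < h * (1 - eps) * - ln (tau * delta) / eps + - ln (tau * delta) / b - 1.
    rewrite subr_gt0 ltr_wpDl // ?ltr_pdivlMr ?mul1r //.
    by rewrite !mulr_ge0 ?invr_ge0 ?ltW.
  have [N [Np NE NL]] := ceil_bound_large e0 b0 X0.
  exists N; split=> //; apply/OP' => p f.
  apply: (@fidelity_bound_tau _ _ lam ord0 eps h b _ (tau * delta)) => //; exact: lamt.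
(* The upper bound also guarantees that the minimum defining [N(eps, delta, Omega)] exists. *)
have exO : exists N, (0 < N)%N && (F <= Fmin N delta Omega Psi).
  by exists N1; rewrite N1p.
have [NO /andP[NOp NOF] NOmin] := ex_minnP exO.
have lower j : j != ord0 -> exists Nj : nat,
    [/\ is_Nnum eps delta (homog_op Psi (lam j)) Psi Nj,
        (Nj <= NO)%N & lb (lam j) <= Nj%:Z].
  move=> j0.
  have exj : exists N, (0 < N)%N && (F <= Fmin N delta (homog_op Psi (lam j)) Psi).
    by exists NO; rewrite NOp OH.
  have [Nj /andP[Njp NjF] Njmin] := ex_minnP exj.
  exists Nj; split.
  - by split=> // M Mp MF; apply: Njmin; rewrite Mp.
  - by apply: Njmin; rewrite NOp OH.
  rewrite /lb -mulrA; apply: kminus_le => //; first by rewrite lam0 lam_lt1.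
  move=> k kp dk; rewrite mulrA.
  have muj : mu j j = lam j by rewrite /mu (negPf j0).
  rewrite -muj; apply: (@homog_lower_bound _ _ (mu j) ord0 j Nj k eps delta) => //.
  - by rewrite muj ltW ?lam_lt1.
  - by rewrite muj.
  - exact/HP'.
exists NO; split.
- by split=> // M Mp MF; apply: NOmin; rewrite Mp.
- by move=> j jp; apply: lower; rewrite -lt0n.
(* [bt] is itself a non-target eigenvalue, with index 1 or the last one, so its bound is an instance
   of [lower]. *)
- have [j j0 ->] : exists2 j, j != ord0 & bt = lam j.
    rewrite /bt; case: ifP => _; last by exists ord_max.
    by exists (inord 1) => //; rewrite -val_eqE /= inordK.
  have [Nj [_ NjO lbj]] := lower j j0.
  by apply: le_trans lbj _; rewrite lez_nat.
- split; first by rewrite -N1E lez_nat NOmin // N1p.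
  rewrite lnq lV ?mulr_gt0 //; apply: ceil_bound_lt => //.
  exact: lt_trans FdL.
- split; first by rewrite -N2E lez_nat NOmin // N2p.
  rewrite lnq lV //; apply: ceil_bound_lt => //.
  exact: lt_trans bL.
Qed.
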